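(* Let $H$ be a complex Hilbert space and $\mathcal{L}$ a skew-adjoint operator on $H$ (the generator of a strongly continuous unitary group $\{\mathcal{U}(t)\}_{t\in\mathbb{R}}$). Let $z\in D(\mathcal{L})$ with $z\neq0$, $\mathcal{P}:=(\cdot,z)(z,z)^{-1}z$, $\mathcal{Q}:=1-\mathcal{P}$. Then $\overline{\mathcal{QL}}\mathcal{Q}$ generates a strongly continuous unitary group $\{\mathcal{G}(t)\}_{t\in\mathbb{R}}$.
   Context: The scalar product $(\cdot,\cdot)$ on $H$ is conjugate-linear in its second argument. The overbar denotes the closure; $D(\overline{\mathcal{QL}}\mathcal{Q})=\{x:\mathcal{Q}x\in D(\overline{\mathcal{QL}})\}$. Skew-adjoint means $\mathcal{L}^\dagger=-\mathcal{L}$. *)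

(* Defs.v *)
(* R : realType, scalars C := R[i] (mathcomp-real-closed complex). *)
From HB Require Import structures.
From mathcomp Require Import all_boot all_order all_algebra.
From mathcomp Require Import complex.
From mathcomp Require Import reals.

Set Implicit Arguments.
Unset Strict Implicit.
Unset Printing Implicit Defensive.
Import Order.TTheory GRing.Theory Num.Theory.
Local Open Scope ring_scope.
Local Open Scope complex_scope.

Section HilbertDefs.
Variable R : realType.
Variable H : lmodType R[i].
(* scalar product, linear in the first argument, conjugate-linear in the second *)
Variable ip : H -> H -> R[i].

Definition inner_product : Prop :=
  [/\ (forall (a : R[i]) (x y w : H), ip (a *: x + y) w = a * ip x w + ip y w),
      (forall x y : H, ip y x = (ip x y)^*),
      (forall x : H, 0 <= ip x x) &
      (forall x : H, ip x x = 0 -> x = 0)].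

(* the norm induced by the scalar product *)
Definition hnorm (x : H) : R := Num.sqrt (complex.Re (ip x x)).

Definition hcauchy (u : nat -> H) : Prop :=
  forall e : R, 0 < e -> exists N : nat,
    forall m n : nat, (N <= m)%N -> (N <= n)%N -> hnorm (u m - u n) < e.

Definition hcvg (u : nat -> H) (x : H) : Prop :=
  forall e : R, 0 < e -> exists N : nat,
    forall n : nat, (N <= n)%N -> hnorm (u n - x) < e.

(* complex Hilbert space: complete inner product space *)
Definition hilbert : Prop :=
  inner_product /\ (forall u, hcauchy u -> exists x, hcvg u x).

(* an (unbounded) operator is given by its domain D and its action L on D *)
Definition linear_operator (D : H -> Prop) (L : H -> H) : Prop :=
  D 0 /\
  (forall (a : R[i]) (x y : H), D x -> D y ->
     D (a *: x + y) /\ L (a *: x + y) = a *: L x + L y).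

Definition dense (D : H -> Prop) : Prop :=
  forall (x : H) (e : R), 0 < e -> exists y, D y /\ hnorm (x - y) < e.

(* graph of the adjoint L^dagger *)
Definition adjoint_graph (D : H -> Prop) (L : H -> H) (y w : H) : Prop :=
  forall x, D x -> ip (L x) y = ip x w.

(* skew-adjoint: densely defined linear operator with L^dagger = - L *)
Definition skew_adjoint (D : H -> Prop) (L : H -> H) : Prop :=
  [/\ linear_operator D L, dense D &
      forall y w, adjoint_graph D L y w <-> (D y /\ w = - L y)].

(* P := (., z)(z, z)^-1 z and Q := 1 - P *)
Definition projP (z x : H) : H := (ip x z / ip z z) *: z.
Definition projQ (z x : H) : H := x - projP z x.

(* graph of the operator Q L, with domain D(L) *)
Definition QL_graph (D : H -> Prop) (L : H -> H) (z : H) (x y : H) : Prop :=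
  D x /\ y = projQ z (L x).

(* closure of a graph (relation) in H x H *)
Definition graph_closure (G : H -> H -> Prop) (x y : H) : Prop :=
  forall e : R, 0 < e -> exists x' y',
    G x' y' /\ hnorm (x' - x) < e /\ hnorm (y' - y) < e.

(* graph of the operator  closure(Q L) Q, with domain {x | Q x \in D(closure(Q L))} *)
Definition closQL_Q_graph (D : H -> Prop) (L : H -> H) (z : H) (x y : H) : Prop :=
  graph_closure (QL_graph D L z) (projQ z x) y.

(* unitary operator: linear, surjective, preserving the scalar product *)
Definition unitary (U : H -> H) : Prop :=
  [/\ (forall (a : R[i]) (x y : H), U (a *: x + y) = a *: U x + U y),
      (forall y, exists x, U x = y) &
      (forall x y, ip (U x) (U y) = ip x y)].

Definition strongly_continuous_unitary_group (G : R -> H -> H) : Prop :=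
  [/\ (forall t, unitary (G t)),
      (forall x, G 0 x = x),
      (forall s t x, G (s + t) x = G s (G t x)) &
      (forall (x : H) (t0 e : R), 0 < e -> exists d : R, 0 < d /\
         forall t : R, `|t - t0| < d -> hnorm (G t x - G t0 x) < e)].

(* graph of the infinitesimal generator: y = lim_{h -> 0} (G h x - x) / h *)
Definition generator_graph (G : R -> H -> H) (x y : H) : Prop :=
  forall e : R, 0 < e -> exists d : R, 0 < d /\
    forall h : R, h != 0 -> `|h| < d ->
      hnorm ((h^-1)%:C *: (G h x - x) - y) < e.

(* the operator with graph A generates the group G *)
Definition generates (G : R -> H -> H) (A : H -> H -> Prop) : Prop :=
  forall x y, generator_graph G x y <-> A x y.

End HilbertDefs.

(* Main.v *)
(* Since [z] lies in [D(L)], [QL - L] and [QLQ - L] are bounded rank-one and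
   rank-two operators on [D(L)]. Hence [QL] is already closed, the closure
   followed by [Q] is [QLQ] with domain [D(L)], and [QLQ] is skew-adjoint.

   The group generated by a skew-adjoint [A] is obtained without functional
   calculus, as [G(t) = lim C(t/2^n)^(2^n)] for the Cayley transforms
   [C(h) = (1 + h/2 A)(1 - h/2 A)^-1]. These are commuting isometries and
   [|C(s) C(t) x - C(s+t) x| <= (|s|+|t|)^2 |A^2 x|] on [D(A^2)], which gives
   both convergence and the group law there, hence everywhere by density.
   The generator of [G] extends [A] and is skew-symmetric, so it equals [A]. *)
Require Import Defs.
From HB Require Import structures.
From mathcomp Require Import all_boot all_order all_algebra.
From mathcomp Require Import complex.
From mathcomp Require Import boolp classical_sets reals.
From mathcomp Require Import ring lra.

Set Implicit Arguments.
Unset Strict Implicit.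
Unset Printing Implicit Defensive.
Import Order.TTheory GRing.Theory Num.Theory.
Local Open Scope ring_scope.
Local Open Scope complex_scope.

(** * The scalar product, its real part and the induced norm *)

Section InnerProduct.
Context (R : realType) (H : lmodType R[i]) (ip : H -> H -> R[i]).
Hypothesis ipP : inner_product ip.
Implicit Types (x y w : H) (a : R[i]) (r s : R).

Local Notation "`[ x ]" := (hnorm ip x) (format "`[ x ]").

Lemma ipC x y : ip y x = conjc (ip x y).
Proof. by case: ipP. Qed.

Lemma ipDl x y w : ip (x + y) w = ip x w + ip y w.
Proof. by case: ipP => + _ _ _ => /(_ 1 x y w); rewrite scale1r mul1r. Qed.

Lemma ip0l w : ip 0 w = 0.
Proof. by apply: (addrI (ip 0 w)); rewrite -ipDl !addr0. Qed.

Lemma ipZl a x w : ip (a *: x) w = a * ip x w.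
Proof.
by case: ipP => + _ _ _ => /(_ a x 0 w); rewrite addr0 ip0l addr0.
Qed.

Lemma ipNl x w : ip (- x) w = - ip x w.
Proof. by rewrite -scaleN1r ipZl mulN1r. Qed.

Lemma ipDr x y w : ip w (x + y) = ip w x + ip w y.
Proof. by rewrite ipC ipDl rmorphD /= -!ipC. Qed.

Lemma ip0r w : ip w 0 = 0.
Proof. by rewrite ipC ip0l conjc0. Qed.

Lemma ipZr a x w : ip w (a *: x) = conjc a * ip w x.
Proof. by rewrite ipC ipZl rmorphM /= -ipC. Qed.

Lemma conjC_real r : conjc (r%:C) = r%:C :> R[i].
Proof. by rewrite /= oppr0. Qed.

Lemma ipZrr r x w : ip w (r%:C *: x) = r%:C * ip w x.
Proof. by rewrite ipZr conjC_real. Qed.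

Lemma ipNr x w : ip w (- x) = - ip w x.
Proof. by rewrite ipC ipNl rmorphN /= -ipC. Qed.

Definition ipE := (ipDl, ipNl, ipZl, ip0l).

Lemma ip_eq0 x : ip x x = 0 -> x = 0.
Proof. by case: ipP => _ _ _; apply. Qed.

(* Reduces identities in [H] to identities in [R[i]], where [ring] applies. *)
Lemma ip_ext x y : (forall w, ip x w = ip y w) -> x = y.
Proof.
move=> xy; apply/eqP; rewrite -subr_eq0; apply/eqP/ip_eq0.
by rewrite ipDl ipNl xy subrr.
Qed.

(** This real scalar product induces the same norm and turns norm estimates into statements over
    [R], within reach of [ring] and [lra]. *)
Definition rip x y : R := complex.Re (ip x y).

Lemma ReD (a b : R[i]) : complex.Re (a + b) = complex.Re a + complex.Re b.
Proof. by case: a b => [? ?] [? ?]. Qed.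

Lemma ReN (a : R[i]) : complex.Re (- a) = - complex.Re a.
Proof. by case: a. Qed.

Lemma ReZ r (a : R[i]) : complex.Re (r%:C * a) = r * complex.Re a.
Proof. by case: a => ? ? /=; rewrite mul0r subr0. Qed.

Lemma ripC x y : rip y x = rip x y.
Proof. by rewrite /rip ipC; case: (ip x y). Qed.

Lemma ripDl x y w : rip (x + y) w = rip x w + rip y w.
Proof. by rewrite /rip ipDl ReD. Qed.

Lemma ripNl x w : rip (- x) w = - rip x w.
Proof. by rewrite /rip ipNl ReN. Qed.

Lemma ripZl r x w : rip (r%:C *: x) w = r * rip x w.
Proof. by rewrite /rip ipZl ReZ. Qed.

Lemma ripDr x y w : rip w (x + y) = rip w x + rip w y.
Proof. by rewrite /rip ipDr ReD. Qed.

Lemma ripNr x w : rip w (- x) = - rip w x.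
Proof. by rewrite /rip ipNr ReN. Qed.

Lemma ripZr r x w : rip w (r%:C *: x) = r * rip w x.
Proof. by rewrite ripC ripZl ripC. Qed.

Definition ripE := (ripDl, ripNl, ripZl, ripDr, ripNr, ripZr).

Lemma Im_ip x y : complex.Im (ip x y) = - rip ('i *: x) y.
Proof.
by rewrite /rip ipZl; case: (ip x y) => ? ? /=; rewrite mul0r mul1r sub0r opprK.
Qed.

Lemma rip_ge0 x : 0 <= rip x x.
Proof. by case: ipP => _ _ /(_ x) + _; rewrite lecE => /andP[]. Qed.

Lemma ipxx x : ip x x = (rip x x)%:C.
Proof.
case: ipP => _ _ /(_ x) + _; rewrite lecE /rip => /andP[/eqP + _].
by case: (ip x x) => ? ? /= ->.
Qed.

Lemma hnorm_sqr x : `[x] ^+ 2 = rip x x.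
Proof. by rewrite sqr_sqrtr ?rip_ge0. Qed.

Lemma hnorm_ge0 x : 0 <= `[x].
Proof. exact: sqrtr_ge0. Qed.

Lemma hnorm_eq0 x : `[x] = 0 -> x = 0.
Proof. by move=> x0; apply: ip_eq0; rewrite ipxx -hnorm_sqr x0 expr0n. Qed.

Lemma hnorm_ip_eq x y : ip x x = ip y y -> `[x] = `[y].
Proof. by rewrite /hnorm => ->. Qed.

Lemma hnormN x : `[- x] = `[x].
Proof. by apply: hnorm_ip_eq; rewrite ipNl ipNr opprK. Qed.

Lemma hnorm_subC x y : `[x - y] = `[y - x].
Proof. by rewrite -hnormN opprB. Qed.

Lemma hnorm0 : `[0] = 0.
Proof. by rewrite /hnorm ip0l sqrtr0. Qed.

Lemma hnormZ r x : `[r%:C *: x] = `|r| * `[x].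
Proof.
apply/eqP; rewrite -(@eqrXn2 _ 2) ?mulr_ge0 ?hnorm_ge0 ?normr_ge0//.
by rewrite exprMn !hnorm_sqr real_normK ?num_real// !ripE mulrA.
Qed.

Lemma hnormi x : `['i *: x] = `[x].
Proof.
apply: hnorm_ip_eq; rewrite ipZl ipZr mulrA.
suff -> : ('i * conjc 'i : R[i]) = 1 by rewrite mul1r.
apply/eqP; rewrite eq_complex /=.
by rewrite !(mul0r, mulr0, mul1r, mulr1, addr0, sub0r, opprK, eqxx).
Qed.

Lemma rip_cauchy_schwarz x y : `|rip x y| <= `[x] * `[y].
Proof.
have [y0|yn0] := eqVneq `[y] 0.
  by rewrite (hnorm_eq0 y0) hnorm0 mulr0 /rip ip0r normr0.
rewrite -(@ler_pXn2r _ 2) ?nnegrE ?mulr_ge0 ?hnorm_ge0 ?normr_ge0//.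
rewrite exprMn real_normK ?num_real// !hnorm_sqr.
have y_gt0 : 0 < rip y y by rewrite -hnorm_sqr exprn_gt0 ?lt_def ?yn0 ?hnorm_ge0.
(* The squared norm of this vector is [rip y y] times the gap in the inequality. *)
have := rip_ge0 ((rip y y)%:C *: x - (rip x y)%:C *: y).
rewrite !ripE (ripC x y) => h.
rewrite -subr_ge0 -(pmulr_rge0 _ y_gt0); apply: le_trans h _.
by rewrite le_eqVlt; apply/orP; left; apply/eqP; ring.
Qed.

Lemma ler_hnormD x y : `[x + y] <= `[x] + `[y].
Proof.
rewrite -(@ler_pXn2r _ 2) ?nnegrE ?addr_ge0 ?hnorm_ge0//.
rewrite sqrrD !hnorm_sqr !ripE (ripC x y).
have := rip_cauchy_schwarz x y; have := ler_norm (rip x y); lra.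
Qed.

Lemma ler_hnormB x y : `[x - y] <= `[x] + `[y].
Proof. by rewrite -(hnormN y) ler_hnormD. Qed.

Lemma ler_hdist w x y : `[x - y] <= `[x - w] + `[w - y].
Proof. by rewrite -[x - y](subrKA w) ler_hnormD. Qed.

Lemma ler_hnormZc a w : `[a *: w] <= (`|complex.Re a| + `|complex.Im a|) * `[w].
Proof.
have -> : a *: w = (complex.Re a)%:C *: w + (complex.Im a)%:C *: ('i *: w).
  by rewrite scalerA -scalerDl {1}[a]complexE mulrC.
by rewrite (le_trans (ler_hnormD _ _))// !hnormZ hnormi mulrDl.
Qed.

(** The factor 2 adds the Cauchy-Schwarz bounds for the real and the imaginary part. *)
Lemma ler_hnorm_ipZ x y w : `[ip x y *: w] <= 2 * (`[x] * `[y]) * `[w].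
Proof.
apply: le_trans (ler_hnormZc _ _) _; apply: ler_wpM2r; first exact: hnorm_ge0.
have := rip_cauchy_schwarz x y; have := rip_cauchy_schwarz ('i *: x) y.
rewrite hnormi Im_ip normrN /rip; lra.
Qed.

Lemma hnorm_small_eq0 x : (forall e : R, 0 < e -> `[x] < e) -> x = 0.
Proof.
move=> h; apply: hnorm_eq0; apply/eqP; case: eqVneq => // xn0.
have : 0 < `[x] by rewrite lt_def xn0 hnorm_ge0.
by move/h; rewrite ltxx.
Qed.

(** * Convergent sequences *)

Lemma hcvg_unique (u : nat -> H) x y : hcvg ip u x -> hcvg ip u y -> x = y.
Proof.
move=> ux uy; apply/eqP; rewrite -subr_eq0; apply/eqP/hnorm_small_eq0 => e e0.
have e20 : 0 < e / 2 by lra.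
have [N hN] := ux _ e20; have [M hM] := uy _ e20.
have := hN _ (leq_maxl N M); have := hM _ (leq_maxr N M).
rewrite (hnorm_subC _ x); have := ler_hdist (u (maxn N M)) x y; lra.
Qed.

Lemma hcvg_cst x : hcvg ip (fun=> x) x.
Proof. by move=> e e0; exists 0%N => n _; rewrite subrr hnorm0. Qed.

Lemma hcvgD (u v : nat -> H) x y :
  hcvg ip u x -> hcvg ip v y -> hcvg ip (fun n => u n + v n) (x + y).
Proof.
move=> ux vy e e0; have e20 : 0 < e / 2 by lra.
have [N hN] := ux _ e20; have [M hM] := vy _ e20.
exists (maxn N M) => n; rewrite geq_max => /andP[/hN + /hM].
rewrite opprD addrACA; have := ler_hnormD (u n - x) (v n - y); lra.
Qed.

Lemma hcvg_bounded_map (T : H -> H) (K : R) (u : nat -> H) x :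
  (forall y, `[T y - T x] <= K * `[y - x]) ->
  hcvg ip u x -> hcvg ip (T \o u) (T x).
Proof.
move=> TK ux e e0; have K0 : 0 < `|K| + 1 by have := normr_ge0 K; lra.
have [N hN] := ux (e / (`|K| + 1)) (divr_gt0 e0 K0).
exists N => n /hN; rewrite ltr_pdivlMr// => h; apply: le_lt_trans (TK _) _.
apply: le_lt_trans h; rewrite mulrC ler_wpM2l ?hnorm_ge0//.
by have := ler_norm K; lra.
Qed.

Lemma hcvgZ r (u : nat -> H) x :
  hcvg ip u x -> hcvg ip (fun n => r%:C *: u n) (r%:C *: x).
Proof.
by apply: (@hcvg_bounded_map _ `|r|) => y; rewrite -scalerBr hnormZ.
Qed.

Lemma hcvgB (u v : nat -> H) x y :
  hcvg ip u x -> hcvg ip v y -> hcvg ip (fun n => u n - v n) (x - y).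
Proof.
move=> ux vy; apply: hcvgD => // e /vy[N hN]; exists N => n /hN.
by rewrite -opprD hnormN.
Qed.

Lemma hcvg_ipZ (u : nat -> H) x y w :
  hcvg ip u x -> hcvg ip (fun n => ip (u n) y *: w) (ip x y *: w).
Proof.
apply: (@hcvg_bounded_map (fun x => ip x y *: w) (2 * `[y] * `[w])) => v.
have -> : ip v y *: w - ip x y *: w = ip (v - x) y *: w by rewrite !ipE scalerBl.
rewrite (le_trans (ler_hnorm_ipZ _ _ _))// le_eqVlt; apply/orP; left; apply/eqP; ring.
Qed.

Lemma hcvg_hnorm_le (u : nat -> H) x y (K : R) :
  hcvg ip u x -> (exists N, forall n, (N <= n)%N -> `[u n - y] <= K) ->
  `[x - y] <= K.
Proof.
move=> ux [M hM]; apply/ler_addgt0Pr => e e0; have [N hN] := ux _ e0.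
have := hN _ (leq_maxl N M); have := hM _ (leq_maxr N M).
have := ler_hdist (u (maxn N M)) x y; rewrite (hnorm_subC x (u _)); lra.
Qed.

Lemma rip_cvg (u v : nat -> H) x y : hcvg ip u x -> hcvg ip v y ->
  forall e : R, 0 < e -> exists N, forall n, (N <= n)%N ->
    `|rip (u n) (v n) - rip x y| < e.
Proof.
move=> ux vy e e0; pose K := `[x] + `[y] + 1.
have K0 : 0 < K by have := hnorm_ge0 x; have := hnorm_ge0 y; rewrite /K; lra.
(* The cap 1 bounds the norm of [v n] by that of [y] plus 1; the other bound keeps [d * K] below
   half of [e]. *)
pose d := Num.min 1 (e / (2 * K)).
have d0 : 0 < d by rewrite lt_min ltr01 divr_gt0// mulr_gt0.
have dK : d * K <= e / 2.
  have : d <= e / (2 * K) by rewrite ge_min lexx orbT.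
  by rewrite ler_pdivlMr ?mulr_gt0// mulrCA => h; rewrite ler_pdivlMr// mulrC.
have [N hN] := ux _ d0; have [M hM] := vy _ d0.
exists (maxn N M) => n; rewrite geq_max => /andP[/hN hu /hM hv].
have -> : rip (u n) (v n) - rip x y = rip (u n - x) (v n) + rip x (v n - y).
  by rewrite !ripE; ring.
have vn : `[v n] <= `[y] + 1.
  have := ler_hnormD (v n - y) y; rewrite subrK.
  have : d <= 1 by rewrite ge_min lexx.
  lra.
have h1 := rip_cauchy_schwarz (u n - x) (v n).
have h2 := rip_cauchy_schwarz x (v n - y).
have h3 : `[u n - x] * `[v n] <= d * (`[y] + 1).
  by rewrite ler_pM ?hnorm_ge0// ltW.
have h4 : `[x] * `[v n - y] <= `[x] * d by rewrite ler_wpM2l ?hnorm_ge0// ltW.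
have := ler_normD (rip (u n - x) (v n)) (rip x (v n - y)).
move: dK; rewrite /K; lra.
Qed.

Lemma rip_lim_eq (u v u' v' : nat -> H) x y x' y' :
  hcvg ip u x -> hcvg ip v y -> hcvg ip u' x' -> hcvg ip v' y' ->
  (forall n, rip (u n) (v n) = rip (u' n) (v' n)) -> rip x y = rip x' y'.
Proof.
move=> ux vy ux' vy' E; apply/eqP; rewrite -subr_eq0 -normr_le0.
apply/ler_addgt0Pr => e e0; have e20 : 0 < e / 2 by lra.
have [N hN] := rip_cvg ux vy e20; have [M hM] := rip_cvg ux' vy' e20.
have := hN _ (leq_maxl N M); have := hM _ (leq_maxr N M); rewrite E.
set c := rip (u' _) _; rewrite (distrC c (rip x y)).
have := ler_distD c (rip x y) (rip x' y'); lra.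
Qed.

(** Up to sign, the imaginary part is the real part with the first argument multiplied by ['i], so
    the real case is applied twice. *)
Lemma ip_lim_eq (u v u' v' : nat -> H) x y x' y' :
  hcvg ip u x -> hcvg ip v y -> hcvg ip u' x' -> hcvg ip v' y' ->
  (forall n, ip (u n) (v n) = ip (u' n) (v' n)) -> ip x y = ip x' y'.
Proof.
move=> ux vy ux' vy' E; apply/eqP; rewrite eq_complex !Im_ip eqr_opp.
have hi (s : nat -> H) w : hcvg ip s w -> hcvg ip (fun n => 'i *: s n) ('i *: w).
  by apply: (@hcvg_bounded_map _ 1) => ?; rewrite -scalerBr hnormi mul1r.
apply/andP; split; apply/eqP.
  by apply: (rip_lim_eq ux vy ux' vy') => n; rewrite /rip E.
apply: (rip_lim_eq (hi _ _ ux) vy (hi _ _ ux') vy') => n.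
by rewrite /rip !ipZl E.
Qed.

Lemma half_pow_small (K e : R) : 0 < e ->
  exists N, forall n, (N <= n)%N -> K / 2 ^+ n < e.
Proof.
move=> e0; exists (Num.bound (K / e)) => n /upper_nthrootP.
by rewrite ltr_pdivrMr// ltr_pdivrMr ?exprn_gt0// mulrC.
Qed.

Lemma hcvg_half_pow (u : nat -> H) x (K : R) :
  (forall n, `[u n - x] <= K / 2 ^+ n) -> hcvg ip u x.
Proof.
move=> h e e0; have [N hN] := half_pow_small K e0; exists N => n /hN.
exact: le_lt_trans (h n).
Qed.

(** * Orthogonal projection onto a closed subspace *)

Lemma parallelogram x y : `[x + y] ^+ 2 + `[x - y] ^+ 2 = 2 * (`[x] ^+ 2 + `[y] ^+ 2).
Proof. by rewrite !hnorm_sqr !ripE; ring. Qed.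

(** At [r = rip x y / rip y y] the quadratic in [r] drops by [rip x y ^+ 2 / rip y y], so minimality
    forces this drop to vanish. *)
Lemma rip_eq0_of_min x y :
  (forall r, `[x] ^+ 2 <= `[x - r%:C *: y] ^+ 2) -> rip x y = 0.
Proof.
move=> h; have [y0|yn0] := eqVneq (rip y y) 0.
  have : `[y] ^+ 2 = 0 by rewrite hnorm_sqr.
  move/eqP; rewrite sqrf_eq0 => /eqP/hnorm_eq0 ->.
  by rewrite /rip ip0r.
have := h (rip x y / rip y y); rewrite !hnorm_sqr !ripE (ripC x y) => {}h.
have y_gt0 : 0 < rip y y by rewrite lt_def yn0 rip_ge0.
have : rip x y ^+ 2 / rip y y <= 0.
  rewrite -oppr_ge0; move: h; rewrite -subr_ge0 => /le_trans; apply.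
  by rewrite le_eqVlt; apply/orP; left; apply/eqP; field.
rewrite pmulr_lle0 ?invr_gt0// => h0; apply/eqP; rewrite -sqrf_eq0.
by rewrite eq_le h0 sqr_ge0.
Qed.

Hypothesis complete : forall u, hcauchy ip u -> exists x, hcvg ip u x.

(** A sequence in [M] minimizing the distance to [v] is Cauchy by the parallelogram law. Its limit
    [w] attains the minimum, which makes [v - w] orthogonal to [M]. *)
Lemma orthogonal_projection (M : H -> Prop) v :
  M 0 -> (forall a x y, M x -> M y -> M (a *: x + y)) ->
  (forall (u : nat -> H) x, (forall n, M (u n)) -> hcvg ip u x -> M x) ->
  exists w, M w /\ forall m, M m -> ip (v - w) m = 0.
Proof.
move=> M0 Mlin Mcl.
pose E := [set q : R | exists m, M m /\ q = `[v - m] ^+ 2]%classic.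
have Einf : has_inf E.
  split; first by exists (`[v - 0] ^+ 2), 0.
  by exists 0 => _ [m [_ ->]]; rewrite sqr_ge0.
have dle m : M m -> inf E <= `[v - m] ^+ 2.
  by move=> Mm; apply: ge_inf; [case: Einf | exists m].
have : forall n : nat, exists m, M m /\ `[v - m] ^+ 2 < inf E + 1 / 2 ^+ n.
  move=> n; have e0 : 0 < (1 : R) / 2 ^+ n by rewrite divr_gt0// exprn_gt0.
  by have [_ [m [Mm ->]] lt] := inf_adherent e0 Einf; exists m.
move=> /choice[u hu].
have Mcomb r s x y : M x -> M y -> M (r%:C *: x + s%:C *: y).
  by move=> Mx My; apply: (Mlin) => //; rewrite -[_ *: y]addr0; apply: Mlin.
(* The midpoint of [u m] and [u n] lies in [M], so its squared distance to [v] is at least [inf E],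
   and the multiples of [inf E] cancel. *)
have uu m n : `[u m - u n] ^+ 2 <= 2 / 2 ^+ m + 2 / 2 ^+ n.
  have [Mm hm] := hu m; have [Mn hn] := hu n.
  have := parallelogram (v - u m) (v - u n).
  have -> : v - u m - (v - u n) = - (u m - u n) by apply: ip_ext => w; rewrite !ipE; ring.
  have -> : v - u m + (v - u n) = 2%:C *: (v - (2^-1%:C *: u m + 2^-1%:C *: u n)).
    by apply: ip_ext => w; rewrite !ipE; field.
  rewrite hnormN hnormZ exprMn ger0_norm//.
  have := dle _ (Mcomb 2^-1 2^-1 _ _ Mm Mn).
  lra.
have : hcauchy ip u.
  move=> e e0; have e20 : 0 < e ^+ 2 / 2 by rewrite divr_gt0// exprn_gt0.
  have [N hN] := half_pow_small 2 e20; exists N => m n /hN hm /hN hn.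
  rewrite -(@ltr_pXn2r _ 2) ?nnegrE ?hnorm_ge0 ?(ltW e0)//.
  by apply: le_lt_trans (uu m n) _; lra.
move=> /complete[w uw].
have Mw : M w by apply: Mcl uw => n; case: (hu n).
have wmin : `[v - w] ^+ 2 <= inf E.
  apply/ler_addgt0Pr => e e0.
  have vu := hcvgB (hcvg_cst v) uw.
  have e20 : 0 < e / 2 by lra.
  have [N1 h1] := rip_cvg vu vu e20; have [N2 h2] := half_pow_small 1 e20.
  have {h1} := h1 _ (leq_maxl N1 N2); have {h2} := h2 _ (leq_maxr N1 N2).
  case: (hu (maxn N1 N2)) => _; rewrite -!hnorm_sqr distrC.
  have := ler_norm (`[v - w] ^+ 2 - `[v - u (maxn N1 N2)] ^+ 2); lra.
exists w; split=> // m Mm.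
have re0 m' : M m' -> rip (v - w) m' = 0.
  move=> Mm'; apply: rip_eq0_of_min => r; apply: le_trans wmin _.
  rewrite -addrA -opprD; apply: dle; rewrite -[w]scale1r addrC.
  by apply: (Mlin) => //; rewrite scale1r.
(* The imaginary part vanishes by applying [re0] to ['i *: m]. *)
apply/eqP; rewrite eq_complex /= Im_ip; apply/andP; split; apply/eqP.
  exact: re0.
apply/eqP; rewrite oppr_eq0 /rip ipZl; apply/eqP.
have := re0 ('i *: m); rewrite -{1}[_ *: m]addr0 => /(_ (Mlin _ _ _ Mm M0)).
rewrite /rip ipZr; case: (ip _ m) => p q /=.
by rewrite !(mul0r, mul1r, mulN1r, sub0r, oppr0, opprK, oppr_eq0) => ->; rewrite oppr0.
Qed.

(** * Skew-adjoint operators *)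

Section SkewAdjoint.
Context (D : H -> Prop) (A : H -> H).
Hypothesis skewA : skew_adjoint ip D A.

Lemma dom0 : D 0.
Proof. by case: skewA => -[]. Qed.

Lemma domZD a x y : D x -> D y -> D (a *: x + y).
Proof. by case: skewA => -[_ h] _ _ Dx Dy; case: (h a x y Dx Dy). Qed.

Lemma opZD a x y : D x -> D y -> A (a *: x + y) = a *: A x + A y.
Proof. by case: skewA => -[_ h] _ _ Dx Dy; case: (h a x y Dx Dy). Qed.

Lemma op0 : A 0 = 0.
Proof.
have := opZD 1 dom0 dom0; rewrite !scale1r addr0 => /eqP.
by rewrite -subr_eq subrr => /eqP <-.
Qed.

Lemma domZ a x : D x -> D (a *: x).
Proof. by move=> Dx; rewrite -[_ *: x]addr0; apply/domZD/dom0. Qed.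

Lemma opZ a x : D x -> A (a *: x) = a *: A x.
Proof.
by move=> Dx; rewrite -[_ *: x]addr0 opZD ?op0 ?addr0//; exact: dom0.
Qed.

Lemma domB x y : D x -> D y -> D (x - y).
Proof. by move=> Dx Dy; rewrite addrC -scaleN1r; apply: domZD. Qed.

Lemma opB x y : D x -> D y -> A (x - y) = A x - A y.
Proof.
by move=> Dx Dy; rewrite addrC -scaleN1r opZD// scaleN1r addrC.
Qed.

Lemma ip_skew x y : D x -> D y -> ip (A x) y = - ip x (A y).
Proof.
move=> Dx Dy; case: skewA => _ _ /(_ y (- A y))[_].
by move=> /(_ (conj Dy erefl)) /(_ x Dx) ->; rewrite ipNr.
Qed.

(** This is the maximality of the domain: a weak identity tested on [D] yields membership in [D]. *)
Lemma skew_adjointP y w : (forall x, D x -> ip (A x) y = - ip x w) ->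
  D y /\ w = A y.
Proof.
move=> h; case: skewA => _ _ /(_ y (- w))[+ _].
case=> [x Dx|Dy /oppr_inj ->//]; by rewrite h// ipNr.
Qed.

Lemma skew_adjoint_closed (u : nat -> H) x y :
  (forall n, D (u n)) -> hcvg ip u x -> hcvg ip (A \o u) y -> D x /\ y = A x.
Proof.
move=> Du ux Auy; apply: skew_adjointP => v Dv; rewrite -ipNl.
apply: (ip_lim_eq (hcvg_cst _) ux (hcvg_cst _) Auy) => n.
by rewrite /= ipNl ip_skew.
Qed.

(** For [k = 0] the hypotheses say nothing about [x] and [y], but both sides vanish. Otherwise [x]
    and [y] are multiples of vectors of [D]. *)
Lemma ip_skew_scaled (k : R) x y : D (k%:C *: x) -> D (k%:C *: y) ->
  ip (A (k%:C *: x)) y = - ip x (A (k%:C *: y)).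
Proof.
have [->|kn0] := eqVneq k 0; first by rewrite !scale0r op0 ip0l ip0r oppr0.
move=> Dx Dy.
have inv_k (v : H) : v = k^-1%:C *: (k%:C *: v).
  by rewrite scalerA -rmorphM /= mulVf// scale1r.
rewrite {1}(inv_k y) {2}(inv_k x) ipZrr ip_skew// ipZl.
by rewrite mulrN !ipZl.
Qed.

(** * Resolvents and Cayley transforms *)

Lemma resolvent_bound (k : R) u x :
  D (k%:C *: u) -> u - A (k%:C *: u) = x -> `[u] <= `[x].
Proof.
move=> Du <-; rewrite -(@ler_pXn2r _ 2) ?nnegrE ?hnorm_ge0// !hnorm_sqr !ripE.
(* Skewness kills the cross term, so the squared norm of [u - A (k u)] is that of [u] plus that of
   [A (k u)]. *)
have h : rip (A (k%:C *: u)) u = 0.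
  have := congr1 (@complex.Re R) (ip_skew_scaled Du Du).
  rewrite ReN -!/(rip _ _) (ripC (A _)); lra.
by rewrite (ripC (A _)) h; have := rip_ge0 (A (k%:C *: u)); lra.
Qed.

Lemma resolvent_unique (k : R) u v :
  D (k%:C *: u) -> D (k%:C *: v) ->
  u - A (k%:C *: u) = v - A (k%:C *: v) -> u = v.
Proof.
move=> Du Dv E; apply/eqP; rewrite -subr_eq0; apply/eqP/hnorm_eq0.
apply/eqP; rewrite eq_le hnorm_ge0 andbT -hnorm0.
apply: (@resolvent_bound k); first by rewrite scalerBr; apply: domB.
rewrite scalerBr opB// -[RHS](subrr (u - A (k%:C *: u))) {2}E.
by apply: ip_ext => w; rewrite !ipE; ring.
Qed.

(* Writing the equation with [A (k u)] instead of [k A u] covers [k = 0] too. *)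
Lemma resolvent_exists (k : R) x :
  exists u, D (k%:C *: u) /\ u - A (k%:C *: u) = x.
Proof.
have [->|kn0] := eqVneq k 0.
  by exists x; rewrite !scale0r op0 subr0; split=> //; exact: dom0.
have kC : k%:C != 0 :> R[i] by rewrite eq_complex /= negb_and kn0.
(* [M] is the range of [1 - k A]. It is closed, and the component of [x] orthogonal to it turns out
   to be zero. *)
pose M y := exists u, D u /\ u - k%:C *: A u = y.
have M0 : M 0 by exists 0; rewrite op0 scaler0 subr0; split=> //; exact: dom0.
have Mlin a y y' : M y -> M y' -> M (a *: y + y').
  move=> [u [Du <-]] [u' [Du' <-]]; exists (a *: u + u').
  split; first exact: domZD.
  by rewrite opZD//; apply: ip_ext => w; rewrite !ipE; ring.
have bound u : D u -> `[u] <= `[u - k%:C *: A u].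
  by move=> Du; apply: (@resolvent_bound k); [exact: domZ|rewrite opZ].
have Mcl (s : nat -> H) y : (forall n, M (s n)) -> hcvg ip s y -> M y.
  move=> /choice[u hu] sy.
  have Du n : D (u n) by case: (hu n).
  have us n : u n - k%:C *: A (u n) = s n by case: (hu n).
  have : hcauchy ip u.
    move=> e e0; have e20 : 0 < e / 2 by lra.
    have [N hN] := sy _ e20; exists N => m n /hN hm /hN hn.
    have := bound _ (domB (Du m) (Du n)).
    have -> : u m - u n - k%:C *: A (u m - u n) = s m - s n.
      by rewrite opB// -!us; apply: ip_ext => w; rewrite !ipE; ring.
    have := ler_hdist y (s m) (s n); rewrite (hnorm_subC y (s n)); lra.
  move=> /complete[v uv].
  (* The equation solved for [A (u n)] shows that these values converge; closedness of [A] then puts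
     [v] into [D]. *)
  have : hcvg ip (A \o u) (k^-1%:C *: (v - y)).
    have := hcvgZ k^-1 (hcvgB uv sy).
    congr hcvg; apply/funext => n /=; rewrite -us.
    by apply: ip_ext => w; rewrite !ipE; field.
  move=> /(skew_adjoint_closed Du uv)[Dv E]; exists v; split=> //.
  by rewrite -E; apply: ip_ext => w; rewrite !ipE; field.
have [y [[u [Du uy]] orth]] := orthogonal_projection x M0 Mlin Mcl.
suff E : x - y = 0.
  exists u; split; first exact: domZ.
  by rewrite opZ// uy; apply/esym/eqP; rewrite -subr_eq0 E.
set d := x - y in orth *.
(* Orthogonality of [d] to the range says weakly that [A d = - d / k]. Then [d + k A d = 0], and the
   resolvent bound at [- k] gives [d = 0]. *)
have [Dd kd] : D d /\ - k^-1%:C *: d = A d.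
  apply: skew_adjointP => v Dv; have := orth _ (ex_intro _ v (conj Dv erefl)).
  rewrite ipDr ipNr ipZrr => /eqP; rewrite subr_eq0 => /eqP h.
  have -> : - k^-1%:C *: d = (- k^-1)%:C *: d by rewrite rmorphN.
  rewrite ipZrr [ip v d]ipC h -ipZrr -ipC ipZl; field.
  exact: kC.
apply: hnorm_eq0; apply/eqP; rewrite eq_le hnorm_ge0 andbT -hnorm0.
apply: (@resolvent_bound (- k)); first exact: domZ.
rewrite opZ// -kd; apply: ip_ext => w; rewrite !ipE; field.
exact: kC.
Qed.

(** This is [(1 - k A)^-1] for every real [k], hence the identity at [k = 0]. *)
Definition resolvent (k : R) x := sval (cid (resolvent_exists k x)).
Local Notation J := resolvent.

Lemma resolvent_dom_scaled k x : D (k%:C *: J k x).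
Proof. by rewrite /J; case: cid => u []. Qed.

Lemma resolventP k x : J k x - A (k%:C *: J k x) = x.
Proof. by rewrite /J; case: cid => u []. Qed.

Lemma resolventE k x u : D (k%:C *: u) -> u - A (k%:C *: u) = x -> J k x = u.
Proof.
move=> Du ux; apply: (resolvent_unique (k := k)) => //.
  exact: resolvent_dom_scaled.
by rewrite resolventP.
Qed.

Lemma resolventZD k a x y : J k (a *: x + y) = a *: J k x + J k y.
Proof.
have Dx := resolvent_dom_scaled k x; have Dy := resolvent_dom_scaled k y.
have E : k%:C *: (a *: J k x + J k y) = a *: (k%:C *: J k x) + k%:C *: J k y.
  by rewrite scalerDr !scalerA mulrC.
apply: resolventE; rewrite E; first exact: domZD.
rewrite opZD// -{3}(resolventP k x) -{3}(resolventP k y).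
by apply: ip_ext => w; rewrite !ipE; ring.
Qed.

Lemma resolvent_le k x : `[J k x] <= `[x].
Proof. exact: resolvent_bound (resolvent_dom_scaled k x) (resolventP k x). Qed.

Lemma resolvent_dom k x : k != 0 -> D (J k x).
Proof.
move=> k0; have := domZ k^-1%:C (resolvent_dom_scaled k x).
by rewrite scalerA -rmorphM /= mulVf// scale1r.
Qed.

Lemma resolvent_stable k x : D x -> D (J k x).
Proof.
have [->|/resolvent_dom//] := eqVneq k 0.
by rewrite (@resolventE 0 x x) ?scale0r ?op0 ?subr0//; exact: dom0.
Qed.

(** Since [k A (J k x) = J k x - x] lies in [D], the vector [A (J k x)] is an admissible solution of
    the equation that defines [J k (A x)]. *)
Lemma op_resolvent k x : D x -> A (J k x) = J k (A x).
Proof.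
move=> Dx; have DJ := resolvent_stable k Dx.
have kAJ : k%:C *: A (J k x) = J k x - x.
  by rewrite -opZ// -{3}(resolventP k x) opprB addrC subrK.
by apply/esym/resolventE; rewrite kAJ ?opB//; [exact: domB | rewrite opprB addrC subrK].
Qed.

Lemma resolvent_sub k x : D x -> J k x - x = k%:C *: J k (A x).
Proof.
move=> Dx; rewrite -op_resolvent// -opZ; last exact: resolvent_stable.
by rewrite -{2}(resolventP k x) opprB addrC subrK.
Qed.

Lemma resolventZ k a x : J k (a *: x) = a *: J k x.
Proof.
rewrite -{1}[_ *: x]addr0 resolventZD (@resolventE k 0 0) ?addr0//.
  by rewrite scaler0; exact: dom0.
by rewrite scaler0 op0 subr0.
Qed.

Lemma resolventB k x y : J k (x - y) = J k x - J k y.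
Proof. by rewrite addrC -scaleN1r resolventZD scaleN1r addrC. Qed.

(** One resolvent commutes with [A] on [D], so it can be applied to the equation that defines the
    other. *)
Lemma resolventC k l x : J k (J l x) = J l (J k x).
Proof.
apply/esym/resolventE; rewrite -resolventZ.
  by apply/resolvent_stable/resolvent_dom_scaled.
by rewrite op_resolvent -?resolventB ?resolventP//; exact: resolvent_dom_scaled.
Qed.

(* The Cayley transform [(1 + h/2 A) (1 - h/2 A)^-1]. *)
Definition cayley (h : R) x := 2%:C *: J (h / 2) x - x.

Lemma cayleyZD h a x y : cayley h (a *: x + y) = a *: cayley h x + cayley h y.
Proof. by rewrite /cayley resolventZD; apply: ip_ext => w; rewrite !ipE; ring. Qed.

Lemma cayleyB h x y : cayley h (x - y) = cayley h x - cayley h y.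
Proof. by rewrite addrC -scaleN1r cayleyZD scaleN1r addrC. Qed.

Lemma cayleyZ h a x : cayley h (a *: x) = a *: cayley h x.
Proof. by rewrite /cayley resolventZ; apply: ip_ext => w; rewrite !ipE; ring. Qed.

(** With [u = J k x] and [a = A (k u)], the transform sends [x = u - a] to [u + a]; by skewness the
    cross terms cancel in both products. *)
Lemma cayley_ip h x y : ip (cayley h x) (cayley h y) = ip x y.
Proof.
pose k := h / 2.
have skew :=
  ip_skew_scaled (resolvent_dom_scaled k x) (resolvent_dom_scaled k y).
have E w : cayley h w = J k w + A (k%:C *: J k w).
  rewrite /cayley -/k -{2}(resolventP k w).
  by apply: ip_ext => v; rewrite !ipE; ring.
rewrite !E -{3}(resolventP k x) -{3}(resolventP k y).
by rewrite !(ipDl, ipDr, ipNl, ipNr) skew; ring.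
Qed.

Lemma cayleyC h l x : cayley h (cayley l x) = cayley l (cayley h x).
Proof.
rewrite /cayley !resolventB !resolventZ resolventC.
by apply: ip_ext => w; rewrite !ipE; ring.
Qed.

Lemma cayley_hnorm h x : `[cayley h x] = `[x].
Proof. by apply: hnorm_ip_eq; rewrite cayley_ip. Qed.

Lemma cayley_sub h x : D x -> cayley h x - x = h%:C *: J (h / 2) (A x).
Proof.
move=> Dx; have -> : h%:C = 2%:C * (h / 2)%:C :> R[i].
  by rewrite -rmorphM /= mulrC divfK ?pnatr_eq0.
rewrite -scalerA -resolvent_sub// /cayley.
by apply: ip_ext => w; rewrite !ipE; ring.
Qed.

Lemma cayley_sub_le h x : D x -> `[cayley h x - x] <= `|h| * `[A x].
Proof.
by move=> Dx; rewrite cayley_sub// hnormZ ler_wpM2l// resolvent_le.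
Qed.

(** The remainder is [h (J - 1) (A x)], and [J - 1 = h/2 J A] on [D] supplies the second factor
    [h]. *)
Lemma cayley_taylor h x : D x -> D (A x) ->
  `[cayley h x - x - h%:C *: A x] <= h ^+ 2 / 2 * `[A (A x)].
Proof.
move=> Dx DAx; rewrite cayley_sub// -scalerBr resolvent_sub// scalerA.
rewrite -rmorphM hnormZ mulrA -expr2 ger0_norm ?divr_ge0 ?sqr_ge0//.
by rewrite ler_wpM2l ?resolvent_le// divr_ge0 ?sqr_ge0.
Qed.

Lemma cayley_add_le s t x : D x -> D (A x) ->
  `[cayley s (cayley t x) - cayley (s + t) x] <=
     (`|s| + `|t|) ^+ 2 * `[A (A x)].
Proof.
move=> Dx DAx.
(* First-order expansions are split off. The four terms contribute at most [t^2 / 2], [s^2 / 2],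
   [|s| |t|] and [(|s| + |t|)^2 / 2], which add up to the stated constant. *)
have -> : cayley s (cayley t x) - cayley (s + t) x =
  (cayley s (cayley t x - x - t%:C *: A x) + (cayley s x - x - s%:C *: A x)) +
  (t%:C *: (cayley s (A x) - A x) -
   (cayley (s + t) x - x - (s + t)%:C *: A x)).
  rewrite (cayleyB s (cayley t x - x)) (cayleyB s (cayley t x) x) cayleyZ.
  by apply: ip_ext => w; rewrite !ipE; ring.
apply: le_trans (ler_hnormD _ _) _.
apply: le_trans (lerD (ler_hnormD _ _) (ler_hnormB _ _)) _.
rewrite cayley_hnorm hnormZ.
have h1 := cayley_taylor t Dx DAx; have h2 := cayley_taylor s Dx DAx.
have h3 := cayley_taylor (s + t) Dx DAx.
have h4 : `|t| * `[cayley s (A x) - A x] <= `|t| * (`|s| * `[A (A x)]).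
  by rewrite ler_wpM2l// cayley_sub_le.
apply: le_trans (lerD (lerD h1 h2) (lerD h4 h3)) _.
have h5 : (s + t) ^+ 2 <= (`|s| + `|t|) ^+ 2.
  by rewrite -(real_normK (num_real (s + t))) lerXn2r ?nnegrE ?addr_ge0// ler_normD.
have h6 : (s + t) ^+ 2 / 2 * `[A (A x)] <= (`|s| + `|t|) ^+ 2 / 2 * `[A (A x)].
  by apply: ler_wpM2r; [exact: hnorm_ge0 | lra].
apply: le_trans (lerD (lexx _) (lerD (lexx _) h6)) _.
rewrite -(real_normK (num_real s)) -(real_normK (num_real t)).
by rewrite le_eqVlt; apply/orP; left; apply/eqP; field.
Qed.

(** * Density of the domain of [A^2] *)

Lemma resolvent_cvg x (e : R) : 0 < e -> exists d : R, 0 < d /\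
  forall k, `|k| < d -> `[J k x - x] < e.
Proof.
move=> e0; case: skewA => _ dense _.
have e40 : 0 < e / 4 by lra.
have [y [Dy xy]] := dense x _ e40.
have K0 : 0 < `[A y] + 1 by have := hnorm_ge0 (A y); lra.
(* Half of [e] pays for [|k|] times the norm of [A y], the other half for twice the distance from
   [x] to [y]. *)
exists (e / 2 / (`[A y] + 1)); split; first by rewrite !divr_gt0.
move=> k; rewrite ltr_pdivlMr// mulrDr mulr1 => hk.
have -> : J k x - x = J k (x - y) - (x - y) + (J k y - y).
  by rewrite resolventB; apply: ip_ext => w; rewrite !ipE; ring.
have := ler_hnormD (J k (x - y) - (x - y)) (J k y - y).
have := ler_hnormB (J k (x - y)) (x - y); have := resolvent_le k (x - y).
have : `[J k y - y] <= `|k| * `[A y].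
  by rewrite resolvent_sub// hnormZ ler_wpM2l// resolvent_le.
have := normr_ge0 k; lra.
Qed.

(** The domain of [A^2] is a core of [A]: since [A (J k x) = J k (A x)], the approximants are
    [J k x] with small nonzero [k]. *)
Lemma op_sqr_core x (e : R) : D x -> 0 < e ->
  exists y, [/\ D y, D (A y), `[x - y] < e & `[A x - A y] < e].
Proof.
move=> Dx e0; have [d1 [d10 h1]] := resolvent_cvg x e0.
have [d2 [d20 h2]] := resolvent_cvg (A x) e0.
pose k := Num.min d1 d2 / 2.
have m0 : 0 < Num.min d1 d2 by rewrite lt_min d10.
have k0 : 0 < k by rewrite divr_gt0.
have km : k < Num.min d1 d2 by rewrite /k; lra.
have kn : k != 0 by rewrite gt_eqF.
exists (J k x); rewrite op_resolvent// !(hnorm_subC _ (J k _)).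
move: km; rewrite lt_min => /andP[k1 k2].
split; [exact: resolvent_dom|exact: resolvent_dom|apply: h1|apply: h2];
  by rewrite gtr0_norm.
Qed.

Lemma op_sqr_dense x (e : R) : 0 < e ->
  exists y, [/\ D y, D (A y) & `[x - y] < e].
Proof.
move=> e0; have e20 : 0 < e / 2 by lra.
case: skewA => _ dense _; have [y [Dy xy]] := dense x _ e20.
have [w [Dw DAw yw _]] := op_sqr_core Dy e20.
by exists w; split=> //; have := ler_hdist y x w; lra.
Qed.

(** * Convergence of the iterated Cayley transforms *)

Lemma iter_dist_le (f g : H -> H) N x :
  (forall y w, `[f y - f w] = `[y - w]) -> (forall y w, `[g y - g w] = `[y - w]) ->
  (forall y, f (g y) = g (f y)) ->
  `[iter N f x - iter N g x] <= N%:R * `[f x - g x].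
Proof.
move=> fi gi fg; elim: N => [|N IH]; first by rewrite subrr hnorm0 mul0r.
have gN y w : `[iter N g y - iter N g w] = `[y - w] by elim: N {IH} => //= N <-.
(* Telescoping: the single [f] that is exchanged for [g] moves past the other factors to act on [x],
   and these isometries then drop out of the distance. *)
have fgN y : f (iter N g y) = iter N g (f y).
  by elim: N {IH gN} => //= N <-.
have := ler_hdist (f (iter N g x)) (iter N.+1 f x) (iter N.+1 g x).
by rewrite {1}iterS fi fgN iterSr gN -natr1 mulrDl mul1r; lra.
Qed.

(** Dyadic step counts let each refinement split every step into two halves. *)
Definition cayley_iter (n : nat) (t : R) x := iter (2 ^ n) (cayley (t / 2 ^+ n)) x.
Local Notation S := cayley_iter.

Lemma cayley_dist h x y : `[cayley h x - cayley h y] = `[x - y].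
Proof. by rewrite -cayleyB cayley_hnorm. Qed.

Lemma cayley_iterZD n t a x y : S n t (a *: x + y) = a *: S n t x + S n t y.
Proof. by rewrite /S; elim: (2 ^ n)%N => //= m ->; rewrite cayleyZD. Qed.

Lemma cayley_iter_ip n t x y : ip (S n t x) (S n t y) = ip x y.
Proof. by rewrite /S; elim: (2 ^ n)%N => //= m IH; rewrite cayley_ip. Qed.

Lemma cayley_iterB n t x y : S n t (x - y) = S n t x - S n t y.
Proof. by rewrite addrC -scaleN1r cayley_iterZD scaleN1r addrC. Qed.

Lemma cayley_iter_dist n t x y : `[S n t x - S n t y] = `[x - y].
Proof. by rewrite -cayley_iterB; apply: hnorm_ip_eq; rewrite cayley_iter_ip. Qed.

Lemma half_powS n (t : R) : t / 2 ^+ n = t / 2 ^+ n.+1 + t / 2 ^+ n.+1.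
Proof. by rewrite exprS; field; rewrite expf_neq0 ?pnatr_eq0. Qed.

(** Each of the [2^n] steps is replaced by two half steps at a cost of [(t / 2^n)^2] times the norm
    of [A (A x)]. *)
Lemma cayley_iter_step n t x : D x -> D (A x) ->
  `[S n.+1 t x - S n t x] <= t ^+ 2 * `[A (A x)] / 2 ^+ n.
Proof.
move=> Dx DAx; rewrite /S expnS mulnC iterM.
apply: le_trans (iter_dist_le _ _ _ _ _) _.
- by move=> y w /=; rewrite !cayley_dist.
- by move=> y w; rewrite cayley_dist.
- by move=> y /=; rewrite ![cayley (t / 2 ^+ n.+1) (cayley (t / 2 ^+ n) _)]cayleyC.
rewrite /= (half_powS n t) natrX.
apply: le_trans (ler_wpM2l _ (cayley_add_le _ _ Dx DAx)) _.
  by rewrite exprn_ge0.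
have p0 : 0 < 2 ^+ n :> R by rewrite exprn_gt0.
rewrite normrM (@gtr0_norm _ (2 ^+ n.+1)^-1) ?invr_gt0 ?exprn_gt0//.
rewrite -half_powS -(real_normK (num_real t)).
by rewrite le_eqVlt; apply/orP; left; apply/eqP; field; rewrite gt_eqF.
Qed.

(** The factor [2 - 2 / 2 ^+ m] is the exact partial sum of the geometric series, so the induction
    closes. *)
Lemma cayley_iter_dist_le n m t x : D x -> D (A x) ->
  `[S (n + m) t x - S n t x] <=
    t ^+ 2 * `[A (A x)] / 2 ^+ n * (2 - 2 / 2 ^+ m).
Proof.
move=> Dx DAx; elim: m => [|m IH].
  by rewrite addn0 subrr hnorm0 expr0 divr1 subrr mulr0.
have := ler_hdist (S (n + m) t x) (S (n + m.+1) t x) (S n t x).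
have := cayley_iter_step (n + m) t Dx DAx; rewrite addnS.
set K := t ^+ 2 * _; move: IH; rewrite -/K => IH h1 h2.
apply: le_trans h2 _; apply: le_trans (lerD h1 IH) _.
have p0 : 2 ^+ n != 0 :> R by rewrite expf_neq0 ?pnatr_eq0.
have q0 : 2 ^+ m != 0 :> R by rewrite expf_neq0 ?pnatr_eq0.
rewrite exprD exprS le_eqVlt; apply/orP; left; apply/eqP; field.
by rewrite ?p0 ?q0.
Qed.

Lemma cayley_iter_dist_le2 n m t x : D x -> D (A x) -> (n <= m)%N ->
  `[S m t x - S n t x] <= 2 * t ^+ 2 * `[A (A x)] / 2 ^+ n.
Proof.
move=> Dx DAx /subnKC <-; apply: le_trans (cayley_iter_dist_le _ _ _ Dx DAx) _.
have -> : 2 * t ^+ 2 * `[A (A x)] / 2 ^+ n = t ^+ 2 * `[A (A x)] / 2 ^+ n * 2 by ring.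
apply: ler_wpM2l.
  by apply: divr_ge0; rewrite ?exprn_ge0// mulr_ge0 ?hnorm_ge0// sqr_ge0.
by rewrite lerBlDr lerDl divr_ge0 ?exprn_ge0.
Qed.

(** The geometric bound settles the domain of [A^2]; as all iterates are isometries, approximating
    [x] from there costs the same for every [n]. *)
Lemma cayley_iter_cvg t x : exists y, hcvg ip (fun n => S n t x) y.
Proof.
apply: complete => e e0; have e40 : 0 < e / 4 by lra.
have [y [Dy DAy xy]] := op_sqr_dense x e40.
have [N hN] := half_pow_small (2 * t ^+ 2 * `[A (A y)]) e40.
have {}hN m : (N <= m)%N -> `[S m t x - S N t y] < e / 2.
  move=> Nm; have := ler_hdist (S m t y) (S m t x) (S N t y).
  rewrite cayley_iter_dist.
  have := cayley_iter_dist_le2 t Dy DAy Nm; have := hN _ (leqnn N); lra.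
exists N => m n /hN hm /hN hn.
by have := ler_hdist (S N t y) (S m t x) (S n t x);
  rewrite (hnorm_subC (S N t y)); lra.
Qed.

(** * The limit group *)

Definition stone_group (t : R) x := sval (cid (cayley_iter_cvg t x)).
Local Notation G := stone_group.

Lemma stone_group_cvg t x : hcvg ip (fun n => S n t x) (G t x).
Proof. by rewrite /G; case: cid. Qed.

Lemma stone_groupZD t a x y : G t (a *: x + y) = a *: G t x + G t y.
Proof.
apply: ip_ext => w.
apply: (ip_lim_eq (stone_group_cvg _ _) (hcvg_cst w)
  (hcvgD _ (stone_group_cvg t y)) (hcvg_cst w)); last first.
  by move=> n; rewrite cayley_iterZD.
apply: (hcvg_bounded_map (T := fun x => a *: x)
  (K := `|complex.Re a| + `|complex.Im a|)) (stone_group_cvg _ _) => v.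
by rewrite -scalerBr ler_hnormZc.
Qed.

Lemma stone_groupB t x y : G t (x - y) = G t x - G t y.
Proof. by rewrite addrC -scaleN1r stone_groupZD scaleN1r addrC. Qed.

Lemma stone_group_ip t x y : ip (G t x) (G t y) = ip x y.
Proof.
apply: (ip_lim_eq (stone_group_cvg _ _) (stone_group_cvg _ _)
  (hcvg_cst x) (hcvg_cst y)) => n.
exact: cayley_iter_ip.
Qed.

Lemma stone_group_hnorm t x : `[G t x] = `[x].
Proof. by apply: hnorm_ip_eq; rewrite stone_group_ip. Qed.

Lemma stone_group_dist t x y : `[G t x - G t y] = `[x - y].
Proof. by rewrite -stone_groupB stone_group_hnorm. Qed.

Lemma eq_on_op_sqr (f g : H -> H) :
  (forall y w, `[f y - f w] = `[y - w]) -> (forall y w, `[g y - g w] = `[y - w]) ->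
  (forall x, D x -> D (A x) -> f x = g x) -> f =1 g.
Proof.
move=> fi gi fg x; apply/eqP; rewrite -subr_eq0; apply/eqP/hnorm_small_eq0.
move=> e e0; have e20 : 0 < e / 2 by lra.
have [y [Dy DAy xy]] := op_sqr_dense x e20.
have := ler_hdist (f y) (f x) (g x).
by rewrite fi (fg y)// gi (hnorm_subC y); lra.
Qed.

Lemma stone_groupD s t x : G (s + t) x = G s (G t x).
Proof.
apply: (eq_on_op_sqr (f := G (s + t)) (g := G s \o G t)) x.
- exact: stone_group_dist.
- by move=> y w /=; rewrite !stone_group_dist.
move=> x Dx DAx /=.
pose K := (`|s| + `|t|) ^+ 2 * `[A (A x)].
(* There are [2^n] steps, each with an error of at most [K / 4^n]. *)
have cvg0 : hcvg ip (fun n => S n (s + t) x - S n s (S n t x)) 0.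
  apply: (hcvg_half_pow (K := K)) => n; rewrite subr0 hnorm_subC /S.
  (* All factors commute, so the two iterations interleave into one. *)
  have -> : iter (2 ^ n) (cayley (s / 2 ^+ n)) (iter (2 ^ n) (cayley (t / 2 ^+ n)) x) =
      iter (2 ^ n) (cayley (s / 2 ^+ n) \o cayley (t / 2 ^+ n)) x.
    elim: (2 ^ n)%N => //= m <-; congr cayley.
    by elim: m (iter m _ x) => //= m IH y; rewrite IH cayleyC.
  apply: le_trans (iter_dist_le _ _ _ _ _) _.
  - by move=> y w /=; rewrite !cayley_dist.
  - by move=> y w; rewrite cayley_dist.
  - by move=> y /=; rewrite (cayleyC (t / _)) (cayleyC (s / _)).
  rewrite /= natrX mulrDl.
  apply: le_trans (ler_wpM2l _ (cayley_add_le _ _ Dx DAx)) _.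
    by rewrite exprn_ge0.
  have p0 : 0 < 2 ^+ n :> R by rewrite exprn_gt0.
  rewrite !normrM !(@gtr0_norm _ (2 ^+ n)^-1) ?invr_gt0// /K.
  by rewrite le_eqVlt; apply/orP; left; apply/eqP; field; rewrite gt_eqF.
apply/eqP; rewrite -subr_eq0; apply/eqP.
apply: hcvg_unique cvg0; apply: hcvgB; first exact: stone_group_cvg.
(* Operator and argument both vary with [n]; as [S n s] is an isometry, the argument [S n t x] can
   first be replaced by its limit. *)
move=> e e0; have e20 : 0 < e / 2 by lra.
have [N hN] := stone_group_cvg t x e20.
have [M hM] := stone_group_cvg s (G t x) e20.
exists (maxn N M) => n; rewrite geq_max => /andP[/hN + /hM].
have := ler_hdist (S n s (G t x)) (S n s (S n t x)) (G s (G t x)).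
by rewrite cayley_iter_dist; lra.
Qed.

Lemma stone_group_sub_le t x : D x -> `[G t x - x] <= `|t| * `[A x].
Proof.
move=> Dx; apply: hcvg_hnorm_le (stone_group_cvg t x) _; exists 0%N => n _.
(* The identity serves as the second commuting isometry in the telescoping estimate. *)
have -> : S n t x - x = S n t x - iter (2 ^ n) id x.
  by congr (_ - _); elim: (2 ^ n)%N => //= m <-.
apply: le_trans (iter_dist_le _ _ _ _ _) _ => //.
  by move=> y w; rewrite cayley_dist.
apply: le_trans (ler_wpM2l _ (cayley_sub_le _ Dx)) _ => //.
have p0 : 0 < 2 ^+ n :> R by rewrite exprn_gt0.
rewrite normrM (@gtr0_norm _ (2 ^+ n)^-1) ?invr_gt0// natrX.
by rewrite le_eqVlt; apply/orP; left; apply/eqP; field; rewrite gt_eqF.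
Qed.

Lemma stone_group0 x : G 0 x = x.
Proof.
apply: (eq_on_op_sqr (f := G 0) (g := id)) x => // [|x Dx _].
  exact: stone_group_dist.
apply/eqP; rewrite -subr_eq0; apply/eqP/hnorm_eq0/eqP.
have := stone_group_sub_le 0 Dx; rewrite normr0 mul0r => h.
by rewrite eq_le h hnorm_ge0.
Qed.

(** The single Cayley step [S 0 t] is within constant 2 of [G t], and its own remainder adds 1/2;
    the sum is rounded up to 3. *)
Lemma stone_group_taylor t x : D x -> D (A x) ->
  `[G t x - x - t%:C *: A x] <= 3 * t ^+ 2 * `[A (A x)].
Proof.
move=> Dx DAx.
have h1 : `[G t x - S 0 t x] <= 2 * t ^+ 2 * `[A (A x)].
  apply: hcvg_hnorm_le (stone_group_cvg t x) _; exists 0%N => n _.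
  by rewrite -[leRHS]divr1; apply: (cayley_iter_dist_le2 (n := 0)).
have := cayley_taylor t Dx DAx; rewrite /S /= expr0 divr1 in h1 *.
have -> : G t x - x - t%:C *: A x =
    (G t x - cayley t x) + (cayley t x - x - t%:C *: A x).
  by apply: ip_ext => w; rewrite !ipE; ring.
have := ler_hnormD (G t x - cayley t x) (cayley t x - x - t%:C *: A x).
have := mulr_ge0 (sqr_ge0 t) (hnorm_ge0 (A (A x))); lra.
Qed.

Lemma stone_group_unitary t : unitary ip (G t).
Proof.
split; [exact: stone_groupZD | | exact: stone_group_ip].
by move=> y; exists (G (- t) y); rewrite -stone_groupD subrr stone_group0.
Qed.

(** Group law and isometry reduce continuity at [t0] to continuity at 0, where a linear bound holds
    on [D]. *)
Lemma stone_group_continuous x t0 (e : R) : 0 < e -> exists d : R, 0 < d /\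
  forall t, `|t - t0| < d -> `[G t x - G t0 x] < e.
Proof.
move=> e0; have e40 : 0 < e / 4 by lra.
have [y [Dy _ xy]] := op_sqr_dense x e40.
have K0 : 0 < `[A y] + 1 by have := hnorm_ge0 (A y); lra.
exists (e / 2 / (`[A y] + 1)); split; first by rewrite !divr_gt0.
move=> t; rewrite ltr_pdivlMr// mulrDr mulr1 => ht.
have -> : G t x = G t0 (G (t - t0) x) by rewrite -stone_groupD addrC subrK.
rewrite stone_group_dist.
have := ler_hdist (G (t - t0) y) (G (t - t0) x) x; rewrite stone_group_dist.
have := ler_hdist y (G (t - t0) y) x; rewrite (hnorm_subC y).
have := stone_group_sub_le (t - t0) Dy; have := normr_ge0 (t - t0); lra.
Qed.

(** * The generator of the limit group *)

Lemma stone_group_generator x : D x -> generator_graph ip G x (A x).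
Proof.
move=> Dx e e0; have e40 : 0 < e / 4 by lra.
have [y [Dy DAy _ Axy]] := op_sqr_core Dx e40.
pose K := 3 * `[A (A y)] + 1.
have K0 : 0 < K by rewrite /K; have := hnorm_ge0 (A (A y)); lra.
exists (e / 4 / K); split; first by rewrite !divr_gt0.
move=> h hn0; rewrite ltr_pdivlMr// => hK.
have hp : 0 < `|h| by rewrite normr_gt0.
have Dxy := domB Dx Dy.
(* The Taylor bound handles [y]. The quotient at [x - y] is at most the norm of [A x - A y], which
   the core property makes small uniformly in [h]. *)
have -> : h^-1%:C *: (G h x - x) - A x =
    h^-1%:C *: (G h (x - y) - (x - y)) +
    (h^-1%:C *: (G h y - y - h%:C *: A y) - (A x - A y)).
  rewrite stone_groupB; apply: ip_ext => w; rewrite !ipE; field.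
  by rewrite eq_complex /= negb_and hn0.
apply: le_lt_trans (ler_hnormD _ _) _; rewrite hnormZ normrV ?unitfE//.
have h1 : `|h|^-1 * `[G h (x - y) - (x - y)] < e / 4.
  apply: le_lt_trans Axy; rewrite ler_pdivrMl// -opB//.
  exact: stone_group_sub_le.
have h2 : `|h|^-1 * `[G h y - y - h%:C *: A y] < e / 4.
  apply: le_lt_trans hK; rewrite ler_pdivrMl//.
  apply: le_trans (stone_group_taylor _ Dy DAy) _.
  rewrite -(real_normK (num_real h)) mulrA -expr2 /K mulrDr mulr1.
  by have := sqr_ge0 `|h|; lra.
have := ler_hnormB (h^-1%:C *: (G h y - y - h%:C *: A y)) (A x - A y).
rewrite hnormZ normrV ?unitfE//; lra.
Qed.

(** Both signs of [s] occur below, since passing to the adjoint reverses time. *)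
Lemma generator_cvg (s : R) x y : generator_graph ip G x y -> s != 0 ->
  hcvg ip (fun n => (s / 2 ^+ n)^-1%:C *: (G (s / 2 ^+ n) x - x)) y.
Proof.
move=> gen s0 e /gen[d [d0 hd]]; have [N hN] := half_pow_small `|s| d0.
exists N => n /hN hn; have p0 : 0 < 2 ^+ n :> R by rewrite exprn_gt0.
apply: hd; first by rewrite mulf_neq0// invr_neq0// gt_eqF.
by rewrite normrM (@gtr0_norm _ (2 ^+ n)^-1) ?invr_gt0.
Qed.

(** The adjoint of [G h] is [G (- h)], so the quotient of [v] at [h] is paired with minus the
    quotient of [x] at [- h]. In the limit [ip (A v) x = - ip v y], and maximality of [D]
    applies. *)
Lemma stone_group_generates x y :
  generator_graph ip G x y <-> D x /\ y = A x.
Proof.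
split=> [gen|[Dx ->]]; last exact: stone_group_generator.
apply: skew_adjointP => v Dv; rewrite -ipNl.
have n10 : (-1 : R) != 0 by rewrite oppr_eq0 oner_eq0.
apply: (ip_lim_eq (generator_cvg (stone_group_generator Dv) (oner_neq0 _))
  (hcvg_cst x) (hcvg_cst (- v)) (generator_cvg gen n10)) => n.
set h := 1 / 2 ^+ n; have -> : -1 / 2 ^+ n = - h by rewrite /h mulNr.
have adj : ip (G h v) x = ip v (G (- h) x).
  by rewrite -(stone_group_ip h v) -stone_groupD subrr stone_group0.
rewrite ipZl ipZrr ipDl ipDr !ipNl !ipNr adj invrN rmorphN /=.
ring.
Qed.

Lemma stone : exists G0 : R -> H -> H,
  strongly_continuous_unitary_group ip G0 /\
  forall x y, generator_graph ip G0 x y <-> D x /\ y = A x.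
Proof.
exists G; split; last exact: stone_group_generates.
split; [exact: stone_group_unitary | exact: stone_group0 |
  exact: stone_groupD | exact: stone_group_continuous].
Qed.

End SkewAdjoint.

(** * The projected operator *)

Section Projected.
Context (D : H -> Prop) (L : H -> H) (z : H).
Hypothesis skewL : skew_adjoint ip D L.
Hypothesis Dz : D z.
Local Notation Q := (projQ ip z).

Lemma projQZD a x y : Q (a *: x + y) = a *: Q x + Q y.
Proof. by rewrite /projQ /projP; apply: ip_ext => w; rewrite !ipE; ring. Qed.

Lemma projQ_ip x y : ip (Q x) y = ip x (Q y).
Proof.
rewrite /projQ /projP !(ipDl, ipDr, ipNl, ipNr) ipZl.
by rewrite [ip x (_ *: z)]ipC ipZl !rmorphM /= fmorphV /= -!ipC; ring.
Qed.

Lemma projQ_dom x : D x -> D (Q x).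
Proof. by move=> Dx; apply: (domB skewL) => //; apply: (domZ skewL). Qed.

Lemma projQ_domV x : D (Q x) -> D x.
Proof.
move=> DQ; have -> : x = projP ip z x + Q x by rewrite /projQ addrC subrK.
exact: (domZD skewL).
Qed.

(** As [z] is in [D], skewness moves [L] onto [z], so the correction to [L] is bounded in [x] and
    passes to limits. *)
Lemma projQ_op x : D x -> Q (L x) = L x + ip x (L z) *: ((ip z z)^-1 *: z).
Proof.
by move=> Dx; rewrite /projQ /projP (ip_skew skewL)// mulNr scaleNr opprK scalerA.
Qed.

(** A vector orthogonal to [D] satisfies the weak identity for [L] at 0, hence equals [L 0]. *)
Lemma ip_dom_inj w w' : (forall x, D x -> ip x w = ip x w') -> w = w'.
Proof.
move=> h; apply/eqP; rewrite -subr_eq0; apply/eqP.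
have [_ ->] : D 0 /\ w - w' = L 0; last exact: op0 skewL.
apply: (skew_adjointP skewL) => x Dx; rewrite ip0r ipDr ipNr h//.
by rewrite subrr oppr0.
Qed.

(** Skew symmetry follows from the symmetry of [Q]; the work is to show that the adjoint has no
    larger domain. For [y] in it, [ip (L x) (Q y)] splits into [ip x w] and a term bounded in
    [x]. *)
Lemma projected_skew_adjoint : skew_adjoint ip D (fun x => Q (L (Q x))).
Proof.
have skewQ x y : D x -> D y -> ip (Q (L (Q x))) y = ip x (- Q (L (Q y))).
  move=> Dx Dy; rewrite ipNr projQ_ip (ip_skew skewL) ?projQ_ip//; exact: projQ_dom.
case: (skewL) => _ dens _; split=> //.
  split=> [|a x y Dx Dy]; first exact: dom0 skewL.
  split; first exact: (domZD skewL).
  by rewrite projQZD (opZD skewL) ?projQZD//; exact: projQ_dom.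
move=> y w; split=> [adj|[Dy ->] x Dx]; last exact: skewQ.
suff Dy : D y.
  by split=> //; apply: ip_dom_inj => x Dx; rewrite -adj// skewQ.
apply: projQ_domV.
(* [L] and [L Q] differ by a bounded rank-one operator since [z] is in [D]. *)
suff [] : D (Q y) /\
  - (w + conjc (ip (L z) (Q y) / ip z z) *: z) = L (Q y) by [].
apply: (skew_adjointP skewL) => x Dx.
have Dc : D (projP ip z x) by apply: (domZ skewL).
have -> : L x = L (Q x) + (ip x z / ip z z) *: L z.
  by rewrite /projQ (opB skewL)// (opZ skewL)// subrK.
rewrite ipDl -projQ_ip adj// ipNr opprK ipDr ipZl ipZr conjcK; ring.
Qed.

Lemma closQL_Q_graphE x y :
  closQL_Q_graph ip D L z x y <-> D x /\ y = Q (L (Q x)).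
Proof.
split=> [cl|[Dx ->] e e0]; last first.
  exists (Q x), (Q (L (Q x))); rewrite !subrr hnorm0; split=> //.
  by split=> //; exact: projQ_dom.
have : forall n : nat, exists p : H * H, QL_graph ip D L z p.1 p.2 /\
    (`[p.1 - Q x] <= 1 / 2 ^+ n /\ `[p.2 - y] <= 1 / 2 ^+ n).
  move=> n; have p0 : 0 < 1 / 2 ^+ n :> R by rewrite divr_gt0// exprn_gt0.
  have [x' [y' [g [hx hy]]]] := cl _ p0.
  by exists (x', y'); split=> //; split; apply: ltW.
move=> /choice[p hp].
have Dp n : D (p n).1 by case: (hp n) => -[].
have p1 : hcvg ip (fun n => (p n).1) (Q x).
  by apply: (hcvg_half_pow (K := 1)) => n; case: (hp n) => _ [].
have p2 : hcvg ip (fun n => (p n).2) y.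
  by apply: (hcvg_half_pow (K := 1)) => n; case: (hp n) => _ [].
(* Removing the rank-one term, which converges along [p1], shows that [L (p n).1] converges, and [L]
   is closed. *)
have [|DQ E] := skew_adjoint_closed skewL Dp p1
    (y := y - ip (Q x) (L z) *: ((ip z z)^-1 *: z)).
  have := hcvgB p2 (hcvg_ipZ (L z) ((ip z z)^-1 *: z) p1).
  congr hcvg; apply/funext => n /=; case: (hp n) => -[_ ->] _.
  by rewrite projQ_op// addrK.
by split; [exact: projQ_domV | rewrite projQ_op// -E subrK].
Qed.

End Projected.
End InnerProduct.

Theorem theorem5 (R : realType) (H : lmodType R[i]) (ip : H -> H -> R[i])
  (D : H -> Prop) (L : H -> H) (z : H) :
  hilbert ip ->
  skew_adjoint ip D L ->
  D z -> z <> 0 ->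
  exists G : R -> H -> H,
    strongly_continuous_unitary_group ip G /\
    generates ip G (closQL_Q_graph ip D L z).
Proof.
move=> [ipP complete] skewL Dz _.
have [G [Gunit Ggen]] :=
  stone ipP complete (projected_skew_adjoint ipP skewL Dz).
exists G; split=> // x y; rewrite Ggen; apply: iff_sym.
exact: closQL_Q_graphE.
Qed.
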